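(* Let $R$ be a finite Frobenius ring, let $m\ge1$, let $C$ be a left (or right) $R$-linear code of length $n$, let $D_C=(E,\alpha_C,\beta_C)$ be the demi-matroid corresponding to $C$, and let $f\in\mathrm{Harm}_d(n)$. Then $$Z^{[m]}_{C,f}(x,y)=Z_{D_C,f}(|R|^m,x,y).$$
   Context: Let $E=\{1,\dots,n\}$, let $0\le d\le n$, and let $E_d$ be the set of $d$-element subsets of $E$. $\mathbb{R}E_d$ is the real vector space with basis $E_d$; its elements $f=\sum_{Z\in E_d}f(Z)Z$ are identified with functions $E_d\to\mathbb{R}$. The linear map $\gamma$ on $\mathbb{R}E_d$ is given by $\gamma(Z)=\sum_{Y\in E_{d-1},\,Y\subseteq Z}Y$ for $Z\in E_d$ (and $\gamma=0$ if $d=0$), and $\mathrm{Harm}_d(n)=\ker(\gamma|_{\mathbb{R}E_d})$. For $f\in\mathbb{R}E_d$ and $X\subseteq E$ put $\widetilde f(X)=\sum_{Z\in E_d,\,Z\subseteq X}f(Z)$; if $f\in\mathrm{Harm}_d(n)$, it is known that $\widetilde f(X)=0$ when $|X|<d$ or $|X|>n-d$. Rings are associative with identity, and $R$ is nonzero. A finite ring $R$ is Frobenius if $R/\mathrm{Rad}(R)\cong\mathrm{Soc}(R_R)$ as right $R$-modules and $R/\mathrm{Rad}(R)\cong\mathrm{Soc}({}_RR)$ as left $R$-modules, where $\mathrm{Rad}$ is the Jacobson radical and $\mathrm{Soc}$ the socle. A left (right) $R$-linear code of length $n$ is a left (right) $R$-submodule of $R^n$. With $\mathbf{u}\cdot\mathbf{v}=\sum_iu_iv_i$,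 the dual of a left code $C$ is the right code $C^\perp=\{\mathbf{u}:\mathbf{v}\cdot\mathbf{u}=0\ \forall\mathbf{v}\in C\}$, and the dual of a right code $C$ is the left code ${}^\perp C=\{\mathbf{u}:\mathbf{u}\cdot\mathbf{v}=0\ \forall\mathbf{v}\in C\}$. For $Y\subseteq E$, the punctured code $C\backslash Y$ is obtained by deleting the coordinates in $Y$ from every codeword. Define, for $X\subseteq E$, $\alpha_C(X)=\log_{|R|}|C\backslash(E-X)|$ and $\beta_C(X)=\log_{|R|}|C'\backslash(E-X)|$, where $C'=C^\perp$ if $C$ is a left code and $C'={}^\perp C$ if $C$ is a right code. A (real) demi-matroid is a triple $D=(E,s,t)$ with $s,t:2^E\to\mathbb{R}$ such that: (D1) if $X\subseteq Y\subseteq E$ then $0\le s(X)\le s(Y)\le|Y|$ and $0\le t(X)\le t(Y)\le|Y|$; (D2) if $X\subseteq E$ then $|E-X|-s(E-X)=t(E)-t(X)$. It is known that $D_C=(E,\alpha_C,\beta_C)$ is a demi-matroid when $R$ is Frobenius. For a demi-matroid $D=(E,s,t)$ and $T\subseteq E$, let $D.T$ denote the contraction $D/(E-T)$, whose first function is $\widehat s(X)=s(X\cup(E-T))-s(E-T)$ for $X\subseteq T$; its characteristic polynomial is $\chi(D.T;\lambda)=\sum_{X\subseteq T}(-1)^{|X|}\lambda^{\widehat s(T)-\widehat s(X)}$. The harmonic coboundary polynomial is $W_{D,f}(\lambda,x,y)=\sum_{T\subseteq E}\widetilde f(T)\chi(D.T;\lambda)x^{|E-T|}y^{|T|}$, and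 $Z_{D,f}$ is the polynomial in $x,y$ with $W_{D,f}(\lambda,x,y)=(xy)^dZ_{D,f}(\lambda,x,y)$, i.e. $Z_{D,f}(\lambda,x,y)=\sum_{T\subseteq E,\,d\le|T|\le n-d}\widetilde f(T)\chi(D.T;\lambda)x^{|E-T|-d}y^{|T|-d}$. With $\mathrm{supp}(\mathbf{u})=\{i\in E:u_i\neq0\}$, let $A^{[m]}_C(X)$ be the number of $(\mathbf{u}_1,\dots,\mathbf{u}_m)\in C^m$ with $\bigcup_j\mathrm{supp}(\mathbf{u}_j)=X$. The $m$-tuple harmonic weight enumerator is $W^{[m]}_{C,f}(x,y)=\sum_{X\subseteq E}\widetilde f(X)A^{[m]}_C(X)x^{|E-X|}y^{|X|}$, and $Z^{[m]}_{C,f}$ is the polynomial with $W^{[m]}_{C,f}(x,y)=(xy)^dZ^{[m]}_{C,f}(x,y)$, i.e. $Z^{[m]}_{C,f}(x,y)=\sum_{X\subseteq E,\,d\le|X|\le n-d}\widetilde f(X)A^{[m]}_C(X)x^{|E-X|-d}y^{|X|-d}$. *)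

(* Defs.v *)
From HB Require Import structures.
From mathcomp Require Import all_boot all_order all_algebra.
From mathcomp Require Import all_classical all_reals all_analysis.

Set Implicit Arguments.
Unset Strict Implicit.
Unset Printing Implicit Defensive.

Import Order.TTheory GRing.Theory Num.Theory.
Local Open Scope ring_scope.

(* The ground set {1, ..., n} is 'I_n; K is the field of real numbers. *)

Section Harmonic.
Variables (K : realType) (n : nat).

Definition dset (d : nat) : finType := {Z : {set 'I_n} | #|Z| == d}.

(* The vector f stands for the formal sum of the f Z * Z. *)
Definition RE (d : nat) : lmodType K := {ffun dset d -> K^o}.

Definition basis_vec (d : nat) (Z : dset d) : RE d :=
  [ffun Y : dset d => (Y == Z)%:R].

(* The case d = 0 must be separated because d.-1 = 0 when d = 0. *)
Definition gamma (d : nat) (f : RE d) : RE d.-1 :=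
  if d == 0%N then 0 else
  \sum_(Z : dset d)
    (f Z : K) *: \sum_(Y : dset d.-1 | val Y \subset val Z) basis_vec Y.

Definition Harm (d : nat) (f : RE d) : Prop := gamma f = 0.

Definition ftilde (d : nat) (f : RE d) (X : {set 'I_n}) : K :=
  \sum_(Z : dset d | val Z \subset X) f Z.

End Harmonic.

Inductive side := Left | Right.

Section FrobeniusRings.
Variable R : finNzRingType.

Definition act (s : side) (a x : R) : R :=
  match s with Left => a * x | Right => x * a end.

Definition is_ideal (s : side) (I : {set R}) : bool :=
  [&& 0 \in I,
      [forall x in I, forall y in I, x + y \in I]
    & [forall a, forall x in I, act s a x \in I]].

Definition maximal_ideal (s : side) (I : {set R}) : bool :=
  maxset (fun J : {set R} => is_ideal s J && (J != [set: R])%SET) I.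

Definition minimal_ideal (s : side) (I : {set R}) : bool :=
  minset (fun J : {set R} => is_ideal s J && (J != [set 0])%SET) I.

(* The Jacobson radical is left-right symmetric, so that the choice of maximal
   left ideals is immaterial. *)
Definition Rad : {set R} :=
  (\bigcap_(I : {set R} | maximal_ideal Left I) I)%SET.

Definition add_set (A B : {set R}) : {set R} :=
  [set a + b | a in A, b in B]%SET.

(* Soc s is the socle of R as a left (s = Left) or right (s = Right) module
   over itself: the sum of its simple submodules. *)
Definition Soc (s : side) : {set R} :=
  \big[add_set/[set 0]%SET]_(I : {set R} | minimal_ideal s I) I.

Definition add_coset (J : {set R}) (x : R) : {set R} :=
  [set x + j | j in J]%SET.

Definition quotient_set (J : {set R}) : {set {set R}} :=
  [set add_coset J x | x in [set: R]]%SET.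

(* R/J and S are isomorphic s-sided R-modules, J and S being s-sided ideals;
   the operations of R/J are (x + J) + (y + J) = (x + y) + J and, for s = Left,
   a (x + J) = a x + J. *)
Definition quotient_iso (s : side) (J S : {set R}) : Prop :=
  exists phi : {set R} -> R,
    [/\ forall x y : R, phi (add_coset J (x + y)) =
                        phi (add_coset J x) + phi (add_coset J y),
        forall a x : R, phi (add_coset J (act s a x)) =
                        act s a (phi (add_coset J x)),
        {in quotient_set J &, injective phi}
      & ([set phi A | A in quotient_set J] = S)%SET].

Definition frobenius : Prop :=
  quotient_iso Right Rad (Soc Right) /\ quotient_iso Left Rad (Soc Left).

End FrobeniusRings.

Section Codes.
Variables (R : finNzRingType) (n : nat).

Definition scale (s : side) (a : R) (u : 'rV[R]_n) : 'rV[R]_n :=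
  \row_i act s a (u 0 i).

Definition linear_code (s : side) (C : {set 'rV[R]_n}) : bool :=
  [&& 0 \in C,
      [forall u in C, forall v in C, u + v \in C]
    & [forall a : R, forall u in C, scale s a u \in C]].

Definition dotp (u v : 'rV[R]_n) : R := \sum_i u 0 i * v 0 i.

Definition dual_code (s : side) (C : {set 'rV[R]_n}) : {set 'rV[R]_n} :=
  match s with
  | Left => [set u | [forall v in C, dotp v u == 0]]%SET
  | Right => [set u | [forall v in C, dotp u v == 0]]%SET
  end.

Definition puncture (C : {set 'rV[R]_n}) (Y : {set 'I_n}) :
    {set 'rV[R]_#|(~: Y)%SET| } :=
  [set colsub (fun k : 'I_#|(~: Y)%SET| => enum_val k) u | u in C]%SET.

Definition supp (u : 'rV[R]_n) : {set 'I_n} := [set i | u 0 i != 0]%SET.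

Definition Acount (m : nat) (C : {set 'rV[R]_n}) (X : {set 'I_n}) : nat :=
  #|[set u : m.-tuple 'rV[R]_n |
      [forall j, tnth u j \in C] &&
      ((\bigcup_(j < m) supp (tnth u j))%SET == X)]%SET|.

End Codes.

Section DemiMatroids.
Variables (K : realType) (I : finType).

(* The data of a demi-matroid with ground set E; only the values of the two
   functions at subsets of E are meaningful. The axioms are stated separately
   in is_demi_matroid, since contractions and characteristic polynomials only
   involve the data. *)
Record demi_data (E : {set I}) := DemiData {
  fst_fun : {set I} -> K;
  snd_fun : {set I} -> K
}.

Definition is_demi_matroid (E : {set I}) (D : demi_data E) : Prop :=
  let s := fst_fun D in let t := snd_fun D in
  (forall X Y : {set I}, X \subset Y -> Y \subset E ->
     (0 <= s X <= s Y /\ s Y <= #|Y|%:R) /\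
     (0 <= t X <= t Y /\ t Y <= #|Y|%:R)) /\
  (forall X : {set I}, X \subset E ->
     #|(E :\: X)%SET|%:R - s (E :\: X)%SET = t E - t X).

Definition contraction (E : {set I}) (D : demi_data E) (A : {set I}) :
    demi_data (E :\: A)%SET :=
  DemiData (E :\: A)%SET
    (fun X => fst_fun D (X :|: A)%SET - fst_fun D A) (snd_fun D).

(* The contraction written D.T *)
Definition contract_to (E : {set I}) (D : demi_data E) (T : {set I}) :=
  contraction D (E :\: T)%SET.

(* Exponents are real, so lambda is a number and not an indeterminate. *)
Definition chi (E : {set I}) (D : demi_data E) (lambda : K) : K :=
  \sum_(X : {set I} | X \subset E)
    (-1) ^+ #|X| * lambda `^ (fst_fun D E - fst_fun D X).

End DemiMatroids.

Definition alpha (K : realType) (R : finNzRingType) (n : nat)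
    (C : {set 'rV[R]_n}) (X : {set 'I_n}) : K :=
  ln (#|puncture C (~: X)%SET|%:R) / ln (#|R|%:R).

Definition D_code (K : realType) (R : finNzRingType) (n : nat) (s : side)
    (C : {set 'rV[R]_n}) : demi_data K [set: 'I_n]%SET :=
  DemiData [set: 'I_n]%SET (alpha K C) (alpha K (dual_code s C)).

Section Enumerators.
Variables (K : realType) (n d : nat).

(* Polynomials in x and y are elements of {poly {poly K}}. *)
Definition px : {poly {poly K}} := 'X.
Definition py : {poly {poly K}} := 'X%:P.

(* When f is harmonic, ftilde f X = 0 unless d <= |X| <= n - d, so
   (xy)^d times the polynomials Z_demi and Z_code below are the harmonic
   coboundary polynomial and the m-tuple harmonic weight enumerator. *)

Definition Z_demi (D : demi_data K [set: 'I_n]%SET) (f : RE K n d)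
    (lambda : K) : {poly {poly K}} :=
  \sum_(T : {set 'I_n} | (d <= #|T| <= n - d)%N)
    (ftilde f T * chi (contract_to D T) lambda)%:P%:P
      * px ^+ (#|(~: T)%SET| - d) * py ^+ (#|T| - d).

Definition Z_code (R : finNzRingType) (m : nat) (C : {set 'rV[R]_n})
    (f : RE K n d) : {poly {poly K}} :=
  \sum_(X : {set 'I_n} | (d <= #|X| <= n - d)%N)
    (ftilde f X * (Acount m C X)%:R)%:P%:P
      * px ^+ (#|(~: X)%SET| - d) * py ^+ (#|X| - d).

End Enumerators.

(* Main.v *)
Require Import Defs.
From HB Require Import structures.
From mathcomp Require Import all_boot all_order all_algebra.
From mathcomp Require Import all_classical all_reals all_analysis.
Set Implicit Arguments.
Unset Strict Implicit.
Unset Printing Implicit Defensive.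
Import Order.TTheory GRing.Theory Num.Theory.
Local Open Scope ring_scope.

(** The two polynomials agree term by term: for every [T] the number of
    [m]-tuples of codewords with support exactly [T] is the characteristic
    polynomial of the contraction to [T], evaluated at [|R|^m].

    Write [C(Y)] for the subcode of the words supported in [Y].  Puncturing to
    the coordinates in [X] is additive with kernel [C(E-X)], so the power of
    [|R|] with exponent [alpha_C(X)] is [|C| / |C(E-X)|]
    ([card_puncture_shortened]).  In the contraction to [T], the exponent
    attached to [X] is [alpha_C(E) - alpha_C(X u (E-T))], and the corresponding
    power of [|R|^m] is therefore [|C(T-X)|^m] ([powR_log_quotient]).  This is
    the number of [m]-tuples whose support is contained in [T-X]
    ([sum_Acount_subset]), and Moebius inversion on the Boolean lattice
    ([mobius_inversion_subsets]) turns the alternating sum of these numbers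
    into the number of tuples with support equal to [T]. *)

(** The sum expands the product over [i] in [A] of [1 + (-1)], which vanishes
    as soon as it has a factor. *)
Lemma alternating_sum_subsets (K : comNzRingType) (I : finType)
    (A : {set I}) :
  \sum_(X : {set I} | X \subset A) (-1) ^+ #|X| = (A == finset.set0)%:R :> K.
Proof.
pose F i : K := if i \in A then -1 else 0.
transitivity (\prod_i (F i + 1)); last first.
  have [A0|] := eqVneq A finset.set0.
    by apply: big1 => i _; rewrite /F A0 inE add0r.
  by case/finset.set0Pn=> i iA; rewrite (bigD1 i) //= /F iA addNr mul0r.
rewrite bigA_distr big_mkcond; apply: eq_bigr => X _.
rewrite -big_mkcond /=.
case: ifPn => [XA|].
  rewrite (eq_bigr (fun=> -1)) ?prodr_const // => i iX.
  by rewrite /F (fintype.subsetP XA).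
by case/fintype.subsetPn=> i iX iA; rewrite (bigD1 i) //= /F (negbTE iA) mul0r.
Qed.

(** After the two sums are exchanged, the coefficient of [a Z] is the
    alternating sum over the subsets of [T - Z], so only [Z = T] survives. *)
Lemma mobius_inversion_subsets (K : comNzRingType) (I : finType)
    (a g : {set I} -> K) (T : {set I}) :
    (forall Y, g Y = \sum_(Z : {set I} | Z \subset Y) a Z) ->
  \sum_(X : {set I} | X \subset T) (-1) ^+ #|X| * g (T :\: X)%SET = a T.
Proof.
move=> ga.
under eq_bigr => X _ do rewrite ga mulr_sumr.
rewrite (exchange_big_dep (fun Z : {set I} => Z \subset T)) /=; last first.
  by move=> X Z _; rewrite finset.subsetD => /andP[].
transitivity (\sum_(Z : {set I} | Z \subset T) (T \subset Z)%:R * a Z).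
  apply: eq_bigr => Z ZT; rewrite -mulr_suml; congr (_ * _).
  rewrite -finset.setD_eq0 -alternating_sum_subsets; apply: eq_bigl => X.
  by rewrite !finset.subsetD ZT disjoint_sym.
rewrite (bigD1 T) //= fintype.subxx mul1r big1 ?addr0 // => Z /andP[ZT].
by rewrite finset.eqEsubset ZT /= => /negbTE->; rewrite mul0r.
Qed.

Section SupportedWords.
Variables (R : finNzRingType) (n : nat).
Implicit Types (C : {set 'rV[R]_n}) (X Y : {set 'I_n}).

Definition supported C Y : {set 'rV[R]_n} :=
  [set u in C | supp u \subset Y]%SET.

(** A left or right code is an additive subgroup: negation is the action of
    the scalar [-1], which acts in the same way on both sides. *)
Lemma linear_code_sub (s : side) C : linear_code s C ->
  {in C &, forall u v, u - v \in C}.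
Proof.
case/and3P=> _ /forall_inP addC /forallP scC u v uC vC.
have -> : - v = scale s (-1) v.
  by apply/rowP=> i; rewrite !mxE; case: s {scC} => /=; rewrite ?mulN1r ?mulrN1.
by apply: (forall_inP (addC u uC)); apply: (forall_inP (scC (-1))).
Qed.

(** A fibre of the projection of [C] to the coordinates in [X] is a coset of
    its kernel, the subcode supported outside [X]. *)
Lemma card_puncture_shortened (s : side) C X : linear_code s C ->
  (#|puncture C (~: X)%SET| * #|supported C (~: X)%SET|)%N = #|C|.
Proof.
move=> linC; have subC := linear_code_sub linC.
have [zeroC /forall_inP addC _] := and3P linC.
rewrite -[RHS]sum1_card.
set p := fun u : 'rV[R]_n => colsub
  (fun k : 'I_#|(~: (~: X))%SET| => enum_val k) u.
have eq_p u v : (p u == p v) = (supp (u - v) \subset (~: X)%SET).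
  apply/eqP/fintype.subsetP=> [puv i|sub].
    rewrite !inE !mxE; apply: contraNN => iX.
    have iXX : i \in (~: (~: X))%SET by rewrite finset.setCK.
    have /rowP/(_ (enum_rank_in iXX i)) := puv.
    by rewrite !mxE enum_rankK_in // => ->; rewrite subrr.
  apply/rowP=> k; rewrite !mxE; apply/eqP; rewrite -subr_eq0.
  apply: contraT => nz; have := enum_valP k; rewrite 2!finset.in_setC negbK => kX.
  by have := sub (enum_val k); rewrite !inE !mxE kX => /(_ nz).
rewrite (partition_big_imset p) /= -sum_nat_const.
apply: eq_bigr => _ /imsetP[u uC ->]; rewrite sum1dep_card.
rewrite -(card_imset _ (addIr u)); apply: eq_card => v; rewrite inE eq_p.
apply/imsetP/andP => [[w]|[vC vX]].
  rewrite inE => /andP[wC wX] ->; rewrite addrK; split=> //.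
  exact: (forall_inP (addC w wC)).
by exists (v - u); rewrite ?subrK // inE subC.
Qed.

(** Both sides count the [m]-tuples of words of [C] that are supported in
    [Y]; the left one sorts them by their joint support. *)
Lemma sum_Acount_subset (m : nat) C Y :
  (\sum_(Z : {set 'I_n} | Z \subset Y) Acount m C Z)%N
    = (#|supported C Y| ^ m)%N.
Proof.
pose S := [set u : m.-tuple 'rV[R]_n |
  [forall j, tnth u j \in supported C Y]]%SET.
pose U (u : m.-tuple 'rV[R]_n) := (\bigcup_(j < m) supp (tnth u j))%SET.
transitivity #|S|.
  rewrite -sum1_card (partition_big U (fun Z => Z \subset Y)) /=.
    apply: eq_bigr => Z ZY; rewrite sum1dep_card /Acount.
    apply: eq_card => u; rewrite !inE -/(U u).
    case: eqP => [UZ|_]; rewrite ?andbF // !andbT.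
    apply/forallP/forallP => H j; last by have := H j; rewrite inE => /andP[].
    rewrite inE H /=; apply: fintype.subset_trans ZY; rewrite -UZ.
    exact: (finset.bigcup_sup j).
  move=> u; rewrite inE => /forallP H; apply/bigcupsP => j _.
  by have := H j; rewrite inE => /andP[].
rewrite -[X in (_ ^ X)%N]card_ord -card_ffun_on.
rewrite -(on_card_preimset (f := @finfun_of_tuple _ m)); last first.
  exact/onW_bij/(Bijective (@finfun_of_tupleK _ m) (@tuple_of_finfunK _ m)).
apply: eq_card => u; rewrite !inE.
by apply/forallP/ffun_onP => H j; have := H j; rewrite ffunE.
Qed.

End SupportedWords.

Lemma powR_log_quotient (K : realType) (q a b : K) (m : nat) :
    1 < q -> 0 < a -> 0 < b ->
  (q ^+ m) `^ (ln a / ln q - ln b / ln q) = (a / b) ^+ m.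
Proof.
move=> q1 a0 b0; have q0 : 0 < q by apply: lt_trans q1.
have lnq0 : ln q != 0 by rewrite gt_eqF // ln_gt0.
rewrite /powR gt_eqF ?exprn_gt0 // lnXn // -mulrBl mulrnAr divfK //.
by rewrite -ln_div // -lnXn ?divr_gt0 // lnK // posrE exprn_gt0 ?divr_gt0.
Qed.

(** The term of [X] counts, up to sign, the tuples supported in [T - X], so the
    characteristic polynomial is a Moebius inversion of the cumulative counts
    [|C(Y)|^m]. *)
Lemma chi_contract_code (K : realType) (R : finNzRingType) (n m : nat)
    (s : side) (C : {set 'rV[R]_n}) (T : {set 'I_n}) :
    linear_code s C ->
  chi (contract_to (D_code K s C) T) (#|R|%:R ^+ m) = (Acount m C T)%:R.
Proof.
move=> linC.
rewrite -(mobius_inversion_subsets (a := fun Z => (Acount m C Z)%:R)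
  (g := fun Y => #|supported C Y|%:R ^+ m)); last first.
  by move=> Y; rewrite -natrX -sum_Acount_subset natr_sum.
have C_gt0 : (0 < #|C|)%N by apply/card_gt0P; exists 0; case/and3P: linC.
have punct_gt0 X : (0 < #|puncture C X|)%N.
  by rewrite -(finset.setCK X); move: C_gt0;
     rewrite -(card_puncture_shortened (~: X)%SET linC) muln_gt0 => /andP[].
have q1 : 1 < #|R|%:R :> K.
  by rewrite ltr1n; apply/card_gt1P; exists 0, 1; rewrite // eq_sym oner_neq0.
rewrite /chi /= !finset.setTD finset.setCK.
apply: eq_bigr => X XT; congr (_ * _).
rewrite opprB addrA subrK /alpha powR_log_quotient ?ltr0n //; congr (_ ^+ _).
(* The puncturing for [alpha_C(E)] is injective: its kernel consists of the
   words with empty support. *)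
have supp0 : supported C (~: (T :|: ~: T))%SET = [set 0]%SET.
  apply/setP=> u; rewrite !inE finset.setUCr finset.setCT finset.subset0.
  apply/andP/eqP => [[_ /eqP u0]|->].
    apply/rowP=> i; rewrite mxE; apply/eqP.
    by have /setP/(_ i) := u0; rewrite !inE => /negbFE.
  split; first by case/and3P: linC.
  by apply/eqP/setP=> i; rewrite !inE mxE eqxx.
have := card_puncture_shortened (T :|: ~: T)%SET linC.
have := card_puncture_shortened (X :|: ~: T)%SET linC.
rewrite supp0 cards1 muln1 finset.setCU finset.setCK finset.setIC -finset.setDE.
by move=> <- ->; rewrite natrM mulrC mulKf // pnatr_eq0 -lt0n.
Qed.

Theorem theorem4p4 (K : realType) (R : finNzRingType) (n d m : nat) (s : side)
    (C : {set 'rV[R]_n}) (f : RE K n d)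
    (hR : frobenius R) (hd : (d <= n)%N) (hm : (1 <= m)%N)
    (hC : linear_code s C) (hf : Harm f) :
  Z_code m C f = Z_demi (D_code K s C) f (#|R|%:R ^+ m).
Proof.
by apply: eq_bigr => T _; rewrite (chi_contract_code K m T hC).
Qed.
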